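(* Let $m\ge1$. The endomorphism semiring $\mathrm{End}(\mathcal{C}_m)$ of the $m$-element chain admits a finite identity basis if and only if $m\le 2$.
   Context: $\mathcal{C}_m$ is the chain $0<1<\dots<m-1$ viewed as a semilattice with $k+\ell:=\max\{k,\ell\}$. $\mathrm{End}(\mathcal{C}_m)$ is the set of all endomorphisms of $\mathcal{C}_m$, made into an additively idempotent semiring (structure of type $(2,2)$) by pointwise addition $x(\alpha+\beta):=x\alpha+x\beta$ and composition $x(\alpha\beta):=(x\alpha)\beta$. A finite identity basis is a finite set of identities valid in the semiring from which all its identities follow. *)

(* Defs.v *)
From Stdlib Require Import List.
From mathcomp Require Import all_boot.
Set Implicit Arguments. Unset Strict Implicit. Unset Printing Implicit Defensive.

Inductive term : Type :=
| Var of nat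
| Add of term & term
| Mul of term & term.

Definition identity := (term * term)%type.

Fixpoint subst (sg : nat -> term) (t : term) : term :=
  match t with
  | Var i => sg i
  | Add a b => Add (subst sg a) (subst sg b)
  | Mul a b => Mul (subst sg a) (subst sg b)
  end.

Inductive derivable (E : list identity) : term -> term -> Prop :=
| der_ax s t sg : In (s, t) E -> derivable E (subst sg s) (subst sg t)
| der_refl t : derivable E t t
| der_sym s t : derivable E s t -> derivable E t s
| der_trans s t u : derivable E s t -> derivable E t u -> derivable E s u
| der_add s1 t1 s2 t2 : derivable E s1 t1 -> derivable E s2 t2 ->
    derivable E (Add s1 s2) (Add t1 t2)
| der_mul s1 t1 s2 t2 : derivable E s1 t1 -> derivable E s2 t2 ->
    derivable E (Mul s1 s2) (Mul t1 t2).

Definition chain_join (m : nat) (k l : 'I_m) : 'I_m := if leq k l then l else k.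

Definition is_endo (m : nat) (f : {ffun 'I_m -> 'I_m}) : Prop :=
  forall k l : 'I_m, f (chain_join k l) = chain_join (f k) (f l).

(* Semiring operations on End(C_m): x(a+b) = xa + xb, x(ab) = (xa)b. *)
Definition end_add (m : nat) (a b : {ffun 'I_m -> 'I_m}) : {ffun 'I_m -> 'I_m} :=
  [ffun x => chain_join (a x) (b x)].
Definition end_mul (m : nat) (a b : {ffun 'I_m -> 'I_m}) : {ffun 'I_m -> 'I_m} :=
  [ffun x => b (a x)].

Fixpoint eval (m : nat) (v : nat -> {ffun 'I_m -> 'I_m}) (t : term)
  : {ffun 'I_m -> 'I_m} :=
  match t with
  | Var i => v i
  | Add a b => end_add (eval v a) (eval v b)
  | Mul a b => end_mul (eval v a) (eval v b)
  end.

Definition holds_in_End (m : nat) (e : identity) : Prop :=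
  forall v : nat -> {ffun 'I_m -> 'I_m}, (forall i, is_endo (v i)) ->
    eval v e.1 = eval v e.2.

Definition End_finitely_based (m : nat) : Prop :=
  exists E : list identity,
    (forall e, In e E -> holds_in_End m e) /\
    (forall s t, holds_in_End m (s, t) -> derivable E s t).

(* Main.v *)
From Stdlib Require Import List Setoid Morphisms.
From mathcomp Require Import all_boot zify.
Require Import Defs.
Set Implicit Arguments. Unset Strict Implicit. Unset Printing Implicit Defensive.

(** Distributing products over sums turns a term into a finite set of words, and
    an identity of End(C_m) says that at each point the maxima of the two sets
    of words, run as compositions of order preserving maps, agree.

    For m = 2 the endomorphisms are the identity and the two constants; beside
    the semiring laws the identities x x = x, x y x = y x and x y <= x + z y
    suffice to derive every inequality "word <= sum of words".

    For m >= 3 fix a bound n on the length of the words in a putative basis.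
    Take more vertices than End(C_m) has elements, and for each pair e = {x, y}
    of vertices many places, at which the word w carries x and y alternately;
    all places are separated by pairwise distinct marks. Exchanging x and y at
    the places of e gives a word w^e. Under any valuation some pair x, y takes
    the same value, so w <= sum of the w^e holds. On the other hand the
    property "p u q is one of the w^e for all words u of t" is invariant under
    the basis: three-state tests show that the basis could only lead from words
    w^e to some w^e or to w; and if it led to w, some w^e would be a
    concatenation of at most n + 2 factors of w, which is impossible since each
    place of e forces a cut. *)

(** * Terms as finite sets of words, and substitution into words *)

Fixpoint words (t : term) : seq (seq nat) :=
  match t with
  | Var i => [:: [:: i]]
  | Add a b => words a ++ words b
  | Mul a b => [seq u ++ v | u <- words a, v <- words b]
  end.

Definition run (S : Type) (d : nat -> S -> S) (p : S) (w : seq nat) : S :=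
  foldl (fun q a => d a q) p w.

Lemma run_cat S (d : nat -> S -> S) p u v : run d p (u ++ v) = run d (run d p u) v.
Proof. by rewrite /run foldl_cat. Qed.

Lemma words_neq_nil t w : w \in words t -> w != [::].
Proof.
elim: t w => [i|a IHa b IHb|a IHa b IHb] w /=; first by rewrite inE => /eqP->.
  by rewrite mem_cat => /orP[/IHa|/IHb].
by case/allpairsP=> -[u v] /= [/IHa + _ ->]; case: u.
Qed.

Lemma words_bounded (E : list identity) :
  exists n, forall s t, In (s, t) E ->
    forall w, w \in words s ++ words t -> size w <= n.
Proof.
elim: E => [|[s t] E [n IH]]; first by exists 0.
exists (\max_(w <- words s ++ words t) size w + n) => s' t' [[<- <-]|/IH H] w w_in.
  by apply: leq_trans (leq_addr _ _); apply: leq_bigmax_seq.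
by apply: leq_trans (H _ w_in) (leq_addl _ _).
Qed.

Fixpoint choices (sg : nat -> term) (w : seq nat) : seq (seq nat) :=
  if w is a :: w' then [seq u ++ v | u <- words (sg a), v <- choices sg w']
  else [:: [::]].

Lemma mem_choices_cat sg w1 w2 u :
  reflect (exists u1 u2, [/\ u1 \in choices sg w1, u2 \in choices sg w2 & u = u1 ++ u2])
          (u \in choices sg (w1 ++ w2)).
Proof.
elim: w1 u => [|a w1 IH] u /=.
  apply: (iffP idP) => [u_in|[u1 [u2 []]]]; first by exists [::], u.
  by rewrite inE => /eqP-> + ->.
apply: (iffP allpairsP) => [[[x y] /= [x_in /IH[u1 [u2 [h1 h2 ->]]] ->]]|].
  exists (x ++ u1), u2; split=> //; last by rewrite catA.
  by apply/allpairsP; exists (x, u1).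
move=> [u1 [u2 [/allpairsP[[x y] /= [hx hy ->]] h2 ->]]].
exists (x, y ++ u2); split=> //=; last by rewrite catA.
by apply/IH; exists y, u2.
Qed.

Lemma mem_words_subst sg t u :
  reflect (exists2 w, w \in words t & u \in choices sg w) (u \in words (subst sg t)).
Proof.
elim: t u => [i|a IHa b IHb|a IHa b IHb] u /=.
- apply: (iffP idP) => [u_in|[w]].
    exists [:: i]; first by rewrite inE.
    by apply/allpairsP; exists (u, [::]); rewrite /= cats0 inE eqxx.
  by rewrite inE => /eqP-> /allpairsP[[x y] /= [x_in]]; rewrite inE => /eqP-> ->; rewrite cats0.
- rewrite mem_cat; apply: (iffP orP) => [[/IHa|/IHb] [w w_in u_in]|[w]].
  + by exists w; rewrite // mem_cat w_in.
  + by exists w; rewrite // mem_cat w_in orbT.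
  + by rewrite mem_cat => /orP[] w_in u_in; [left; apply/IHa|right; apply/IHb]; exists w.
- apply: (iffP allpairsP) => [[[x y] /= [/IHa[w1 hw1 hx] /IHb[w2 hw2 hy] ->]]|].
    exists (w1 ++ w2); first by apply/allpairsP; exists (w1, w2).
    by apply/mem_choices_cat; exists x, y.
  case=> w /allpairsP[[w1 w2] /= [hw1 hw2 ->]] /mem_choices_cat[u1 [u2 [h1 h2 ->]]].
  exists (u1, u2); split=> //=; first by apply/IHa; exists w1.
  by apply/IHb; exists w2.
Qed.

(** * Evaluation as a maximum of runs over words *)

Section Evaluation.

Variable m : nat.
Implicit Types (x y z : 'I_m) (v : nat -> {ffun 'I_m -> 'I_m}).

Lemma val_chain_join x y : chain_join x y = maxn x y :> nat.
Proof. by rewrite /chain_join; case: leqP. Qed.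

Lemma endo_mono (f : {ffun 'I_m -> 'I_m}) :
  is_endo f <-> {homo f : x y / x <= y}.
Proof.
split=> [f_endo x y le_xy|f_mono x y].
  have := f_endo x y; rewrite {1}/chain_join le_xy => ->.
  by rewrite val_chain_join leq_maxl.
apply: val_inj; rewrite /= val_chain_join /chain_join.
case: leqP => [/f_mono/maxn_idPr->|/ltnW/f_mono/maxn_idPl->] //.
Qed.

Lemma run_endo_mono v w : (forall i, is_endo (v i)) ->
  {homo run v ^~ w : x y / x <= y}.
Proof.
move=> v_endo; elim: w => [//|a w IH] x y le_xy /=.
by apply: IH; move: (v_endo a) => /endo_mono; apply.
Qed.

(** Monotonicity carries the bound on the first factor through the second factor of a product. With
    [eval_attained], [eval v t x] becomes the maximum of the runs from [x] over the words of [t]. *)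
Lemma eval_ub v t x w : (forall i, is_endo (v i)) -> w \in words t ->
  run v x w <= eval v t x.
Proof.
move=> v_endo; elim: t x w => [i|a IHa b IHb|a IHa b IHb] x w /=.
- by rewrite inE => /eqP->.
- rewrite mem_cat ffunE val_chain_join leq_max.
  by case/orP=> [/IHa->|/IHb->]; rewrite ?orbT.
- case/allpairsP=> -[u1 u2] /= [/IHa h1 /IHb h2 ->]; rewrite ffunE run_cat.
  by apply: leq_trans (h2 _); apply: run_endo_mono.
Qed.

(** A join in a chain is one of its two arguments, so a summand can be selected at each sum. *)
Lemma eval_attained v t x : exists2 w, w \in words t & run v x w = eval v t x.
Proof.
elim: t x => [i|a IHa b IHb|a IHa b IHb] x /=.
- by exists [:: i]; rewrite ?inE.
- rewrite ffunE /chain_join; case: ifP => _.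
    by have [w ? ?] := IHb x; exists w; rewrite // mem_cat orbC; apply/orP; left.
  by have [w ? ?] := IHa x; exists w; rewrite // mem_cat; apply/orP; left.
- have [u hu eu] := IHa x; have [w hw ew] := IHb (eval v a x).
  exists (u ++ w); first by apply/allpairsP; exists (u, w).
  by rewrite run_cat eu ffunE.
Qed.

Lemma holds_words s t :
  (forall v x, (forall i, is_endo (v i)) ->
    (forall w, w \in words s -> exists2 w', w' \in words t & run v x w <= run v x w') /\
    (forall w, w \in words t -> exists2 w', w' \in words s & run v x w <= run v x w')) ->
  holds_in_End m (s, t).
Proof.
move=> H v v_endo /=; apply/ffunP => x; apply/val_inj/eqP; have [H1 H2] := H v x v_endo.
rewrite eqn_leq; apply/andP; split.
  have [w hw <-] := eval_attained v s x; have [w' hw' le] := H1 _ hw.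
  exact: leq_trans le (eval_ub _ v_endo hw').
have [w hw <-] := eval_attained v t x; have [w' hw' le] := H2 _ hw.
exact: leq_trans le (eval_ub _ v_endo hw').
Qed.

Lemma eval_endo v t : (forall i, is_endo (v i)) -> is_endo (eval v t).
Proof.
move=> v_endo; apply/endo_mono => x y le_xy.
have [w hw <-] := eval_attained v t x.
by apply: leq_trans (eval_ub y v_endo hw); apply: run_endo_mono.
Qed.

Lemma eval_subst v sg t : eval v (subst sg t) = eval (fun i => eval v (sg i)) t.
Proof. by elim: t => //= a -> b ->. Qed.

Lemma holds_subst s t sg : holds_in_End m (s, t) ->
  holds_in_End m (subst sg s, subst sg t).
Proof.
by move=> H v v_endo /=; rewrite !eval_subst; apply: H => i; apply: eval_endo.
Qed.

Lemma holds_sym s t : holds_in_End m (s, t) -> holds_in_End m (t, s).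
Proof. by move=> H v /H. Qed.

End Evaluation.

(* An action of the letters on the chain 0 < ... < k by order preserving maps,
   extended to all of nat. *)
Definition tame (k : nat) (d : nat -> nat -> nat) :=
  (forall a, {homo d a : i j / i <= j}) /\ (forall a i, d a i <= k).

Lemma run_tame_mono k d w : tame k d -> {homo run d ^~ w : i j / i <= j}.
Proof. by move=> [d_mono _]; elim: w => //= a w IH i j /(d_mono a)/IH. Qed.

Lemma run_tame_le k d p w : tame k d -> p <= k -> run d p w <= k.
Proof. by move=> [_ d_le]; elim: w p => //= a w IH p _; apply: IH. Qed.

(** An action on the states [0..k] becomes a valuation in End(C_m), since [tame] bounds all values
    by [k < m]. The necessary conditions on identities below come from choosing such a test [d]. *)
Lemma holds_run m k d s t p w : k < m -> tame k d -> holds_in_End m (s, t) ->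
  p <= k -> w \in words s -> exists2 w', w' \in words t & run d p w <= run d p w'.
Proof.
case: m => // m lt_km [d_mono d_le] st_eq le_pk w_in.
pose v a : {ffun 'I_m.+1 -> 'I_m.+1} := [ffun x : 'I_m.+1 => inord (d a x)].
have vE a x : v a x = d a x :> nat by rewrite ffunE inordK // (leq_ltn_trans (d_le a x)).
have v_endo a : is_endo (v a) by apply/endo_mono => x y le_xy; rewrite !vE d_mono.
have runE x u : run v x u = run d x u :> nat by elim: u x => //= a u IH x; rewrite IH vE.
have p0 : (inord p : 'I_m.+1) = p :> nat by rewrite inordK // (leq_ltn_trans le_pk).
have [w' w'_in eq_w'] := eval_attained v t (inord p).
exists w' => //; rewrite -p0 -!runE eq_w' -(st_eq v v_endo).
exact: eval_ub.
Qed.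

(** * Chains with at most two elements *)

Lemma End1_finitely_based : End_finitely_based 1.
Proof.
exists [:: (Var 0, Var 1)]; split=> [e _ v _|s t _].
  by apply/ffunP => x; apply: val_inj; rewrite /= !ord1.
have := @der_ax [:: (Var 0, Var 1)] (Var 0) (Var 1) (fun i => if i is 0 then s else t).
by apply; left.
Qed.

(** Six semiring laws come first. The last identity encodes the inequality x y <= x + z y as an
    equation. *)
Definition End2_basis : list identity :=
  let x := Var 0 in let y := Var 1 in let z := Var 2 in
  [:: (Add x (Add y z), Add (Add x y) z);
      (Add x y, Add y x);
      (Add x x, x);
      (Mul x (Mul y z), Mul (Mul x y) z);
      (Mul x (Add y z), Add (Mul x y) (Mul x z));
      (Mul (Add x y) z, Add (Mul x z) (Mul y z));
      (Mul x x, x);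
      (Mul x (Mul y x), Mul y x);
      (Add (Add x (Mul z y)) (Mul x y), Add x (Mul z y))].

Section ChainJoin.
Variable m : nat.
Implicit Types x y z : 'I_m.

Lemma chain_joinA x y z : chain_join x (chain_join y z) = chain_join (chain_join x y) z.
Proof. by apply: val_inj; rewrite /= !val_chain_join maxnA. Qed.

Lemma chain_joinC x y : chain_join x y = chain_join y x.
Proof. by apply: val_inj; rewrite /= !val_chain_join maxnC. Qed.

Lemma chain_joinxx x : chain_join x x = x.
Proof. by apply: val_inj; rewrite /= !val_chain_join maxnn. Qed.

End ChainJoin.

(** Of the four self-maps only the exchange of the two elements fails to be monotone. *)
Lemma endo_I2 (f : {ffun 'I_2 -> 'I_2}) :
  is_endo f -> (forall x, f x = x) \/ (exists c, forall x, f x = c).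
Proof.
move=> /endo_mono/(_ ord0 ord_max isT).
have casex (x : 'I_2) : x = ord0 \/ x = ord_max.
  by case: x => -[|[|//]] i; [left|right]; apply: val_inj.
case: (casex (f ord0)) (casex (f ord_max)) => e0 [] e1; rewrite e0 e1 // => _.
- by right; exists ord0 => x; case: (casex x) => ->.
- by left=> x; case: (casex x) => ->.
- by right; exists ord_max => x; case: (casex x) => ->.
Qed.

Lemma End2_basis_sound e : In e End2_basis -> holds_in_End 2 e.
Proof.
move=> e_in v v_endo; apply/ffunP => x.
have E0 := v_endo 0; have E1 := v_endo 1; have E2 := v_endo 2.
repeat (case: e_in => [<-|e_in]); rewrite /= ?ffunE.
- exact: chain_joinA.
- exact: chain_joinC.
- exact: chain_joinxx.
- by [].
- by [].
- exact: E2.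
- by case: (endo_I2 E0) => [H|[c H]]; rewrite !H.
- by case: (endo_I2 E0) => [H|[c H]]; rewrite !H.
- case: (endo_I2 E1) => [H|[c H]]; rewrite !H; last by rewrite -chain_joinA chain_joinxx.
  by rewrite chain_joinC chain_joinA chain_joinxx.
Qed.

Local Notation "s ≈ t" := (derivable End2_basis s t) (at level 70).

#[local] Instance derivable_equivalence E : Equivalence (derivable E).
Proof. by split; [exact: der_refl | exact: der_sym | exact: der_trans]. Qed.

#[local] Hint Resolve der_refl : core.

#[local] Instance Add_derivable E :
  Proper (derivable E ==> derivable E ==> derivable E) Add.
Proof. by move=> ? ? ? ? ? ?; apply: der_add. Qed.

#[local] Instance Mul_derivable E :
  Proper (derivable E ==> derivable E ==> derivable E) Mul.
Proof. by move=> ? ? ? ? ? ?; apply: der_mul. Qed.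

Definition subst3 (x y z : term) (i : nat) : term :=
  match i with 0 => x | 1 => y | _ => z end.

Lemma End2_axiom i x y z : i < size End2_basis ->
  let e := nth (Var 0, Var 0) End2_basis i in
  subst (subst3 x y z) e.1 ≈ subst (subst3 x y z) e.2.
Proof.
move=> lt_i e; apply: der_ax; rewrite -surjective_pairing /e {e}.
by do 9 (case: i lt_i => [_|i lt_i]; [by left | right]).
Qed.

Lemma AddA x y z : Add x (Add y z) ≈ Add (Add x y) z.
Proof. exact: (@End2_axiom 0 x y z). Qed.
Lemma AddC x y : Add x y ≈ Add y x. Proof. exact: (@End2_axiom 1 x y y). Qed.
Lemma Addxx x : Add x x ≈ x. Proof. exact: (@End2_axiom 2 x x x). Qed.
Lemma MulA x y z : Mul x (Mul y z) ≈ Mul (Mul x y) z. Proof. exact: (@End2_axiom 3 x y z). Qed.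
Lemma MulDr x y z : Mul x (Add y z) ≈ Add (Mul x y) (Mul x z).
Proof. exact: (@End2_axiom 4 x y z). Qed.
Lemma MulDl x y z : Mul (Add x y) z ≈ Add (Mul x z) (Mul y z).
Proof. exact: (@End2_axiom 5 x y z). Qed.
Lemma Mulxx x : Mul x x ≈ x. Proof. exact: (@End2_axiom 6 x x x). Qed.
Lemma MulxyX x y : Mul x (Mul y x) ≈ Mul y x. Proof. exact: (@End2_axiom 7 x y y). Qed.
Lemma Add_interpolate x y z : Add (Add x (Mul z y)) (Mul x y) ≈ Add x (Mul z y).
Proof. exact: (@End2_axiom 8 x y z). Qed.

(** * The order derivable from the basis for the two-element chain *)

Local Notation "s ≽ t" := (Add s t ≈ s) (at level 70).

Lemma ge_trans s t u : s ≽ t -> t ≽ u -> s ≽ u.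
Proof. by move=> st tu; rewrite -st -AddA tu. Qed.

Lemma ge_Add s t u : s ≽ t -> s ≽ u -> s ≽ Add t u.
Proof. by move=> st su; rewrite AddA st. Qed.

Lemma ge_Addl s t : Add s t ≽ s.
Proof. by rewrite AddC AddA Addxx. Qed.

Lemma ge_Addr s t : Add s t ≽ t.
Proof. by rewrite -AddA Addxx. Qed.

Lemma ge_Mul s s' t t' : s ≽ s' -> t ≽ t' -> Mul s t ≽ Mul s' t'.
Proof.
move=> ss' tt'; apply: (@ge_trans _ (Mul s t')).
  by rewrite -MulDr tt'.
by rewrite -MulDl ss'.
Qed.

Lemma ge_eqr s t t' : t ≈ t' -> s ≽ t -> s ≽ t'.
Proof. by move=> <-. Qed.

Lemma ge_anti s t : s ≽ t -> t ≽ s -> s ≈ t.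
Proof. by move=> st ts; rewrite -st AddC. Qed.

(** The last identity of the basis allows the prefix [z] of a product below [s] to be replaced by
    any [x] below [s]. *)
Lemma ge_interpolate s x y z : s ≽ x -> s ≽ Mul z y -> s ≽ Mul x y.
Proof.
move=> sx szy; apply: ge_trans (ge_Add sx szy) _; exact: Add_interpolate.
Qed.

(* The empty word is sent to the junk value [Var 0]. *)
Fixpoint word_term (w : seq nat) : term :=
  match w with
  | [::] => Var 0
  | [:: a] => Var a
  | a :: w' => Mul (Var a) (word_term w')
  end.

Lemma word_term_cons a w : w != [::] -> word_term (a :: w) = Mul (Var a) (word_term w).
Proof. by case: w. Qed.

Lemma word_term_cat u w : u != [::] -> w != [::] ->
  word_term (u ++ w) ≈ Mul (word_term u) (word_term w).
Proof.
move=> + w0; elim: u => // a [|b u] IH _; first by rewrite cat1s word_term_cons.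
by rewrite cat_cons word_term_cons // IH // (word_term_cons _ (w := b :: u)) // MulA.
Qed.

Lemma ge_words s w : w \in words s -> s ≽ word_term w.
Proof.
elim: s w => [i|a IHa b IHb|a IHa b IHb] w /=.
- by rewrite inE => /eqP->; exact: Addxx.
- rewrite mem_cat => /orP[/IHa|/IHb]; apply: ge_trans; [exact: ge_Addl|exact: ge_Addr].
- case/allpairsP=> -[u1 u2] /= [h1 h2 ->].
  rewrite word_term_cat ?(words_neq_nil h1) ?(words_neq_nil h2) //.
  by apply: ge_Mul; [exact: IHa|exact: IHb].
Qed.

(** The signature has no unit, so [None] stands for an absent factor. *)
Definition context (p q : option term) (t : term) : term :=
  let t' := if q is Some r then Mul t r else t in
  if p is Some l then Mul l t' else t'.

Lemma context_Add p q a b : context p q (Add a b) ≈ Add (context p q a) (context p q b).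
Proof. by case: p q => [l|] [r|] /=; rewrite ?MulDl ?MulDr. Qed.

#[local] Instance context_derivable p q :
  Proper (derivable End2_basis ==> derivable End2_basis) (context p q).
Proof. by move=> a b ab; case: p q => [l|] [r|] /=; rewrite ab. Qed.

(** The context makes the induction pass through products: [b] is first moved into the right context
    of [a], then each word of [a] into the left context of [b]. *)
Lemma ge_context_of_words s t p q :
  (forall w, w \in words t -> s ≽ context p q (word_term w)) -> s ≽ context p q t.
Proof.
elim: t p q => [i|a IHa b IHb|a IHa b IHb] p q H /=.
- by apply: (H [:: i]); rewrite inE.
- rewrite context_Add; apply: ge_Add.
    by apply: IHa => w hw; apply: H; rewrite /= mem_cat hw.
  by apply: IHb => w hw; apply: H; rewrite /= mem_cat hw orbT.
- have mulr q' : context p q (Mul a q') ≈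
    context p (Some (if q is Some r then Mul q' r else q')) a.
    by case: p q {H} => [l|] [r|] /=; rewrite ?MulA.
  rewrite mulr; apply: IHa => u hu.
  have mull q' : context p q (Mul (word_term u) q') ≈
    context (Some (if p is Some l then Mul l (word_term u) else word_term u)) q q'.
    by case: p q {H mulr} => [l|] [r|] /=; rewrite ?MulA.
  have mulr' q' : context p q (Mul (word_term u) q') ≈
    context p (Some (if q is Some r then Mul q' r else q')) (word_term u).
    by case: p q {H mulr mull} => [l|] [r|] /=; rewrite ?MulA.
  rewrite -mulr' mull; apply: IHb => w hw.
  rewrite -mull -word_term_cat ?(words_neq_nil hu) ?(words_neq_nil hw) //.
  by apply: H; apply/allpairsP; exists (u, w).
Qed.

Lemma ge_of_words s t : (forall w, w \in words t -> s ≽ word_term w) -> s ≽ t.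
Proof. exact: (@ge_context_of_words s t None None). Qed.

(** At an occurrence of [a] idempotency applies. An earlier letter [b] is passed by a b a = b a,
    because the tail after [b] already absorbs [a]. *)
Lemma Mul_letter_absorb a y : a \in y -> Mul (Var a) (word_term y) ≈ word_term y.
Proof.
elim: y => // b y IH; rewrite inE => /orP[/eqP<-|a_y].
  case: y {IH} => [|c y]; first exact: Mulxx.
  by rewrite word_term_cons // MulA Mulxx.
have y0 : y != [::] by case: y a_y {IH}.
rewrite word_term_cons // -(IH a_y).
by rewrite (MulA (Var b)) (MulA (Var a)) MulxyX.
Qed.

Lemma Mul_word_absorb z y : z != [::] -> {subset z <= y} ->
  Mul (word_term z) (word_term y) ≈ word_term y.
Proof.
elim: z => // a [|b z] IH _ sub; first by apply: Mul_letter_absorb; apply: sub; rewrite inE.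
rewrite word_term_cons // -MulA IH //; last by move=> c c_z; apply: sub; rewrite inE c_z orbT.
by apply: Mul_letter_absorb; apply: sub; rewrite inE eqxx.
Qed.

(** * Two-state tests, and derivability for the two-element chain *)

Section Conditions.

Variables (s t : term) (u : seq nat).
Hypotheses (st_eq : holds_in_End 2 (s, t)) (u_t : u \in words t).

(** In the test, letters of [u] fix both states and all others reset to 0. As [u] keeps state 1, so
    does some word of [s]. *)
Lemma End2_subword : exists2 w, w \in words s & {subset w <= u}.
Proof.
pose d a i := if a \in u then minn i 1 else 0.
have d_tame : tame 1 d by split=> [a i j|a i]; rewrite /d; case: ifP => _; lia.
have run1 w : {subset w <= u} -> run d 1 w = 1.
  elim: w => //= a w IH sub; rewrite /d sub ?inE ?eqxx //; apply: IH => b b_w.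
  by apply: sub; rewrite inE b_w orbT.
have d0 a : d a 0 = 0 by rewrite /d min0n if_same.
have run0 w : run d 0 w = 0 by elim: w => //= a w; rewrite d0.
have [w w_s] := holds_run (ltnSn 1) d_tame (holds_sym st_eq) (leqnn 1) u_t.
rewrite run1 // => w_run; exists w => //.
elim: w w_run {w_s} => //= a w IH; have [a_u|a_u] := boolP (a \in u); last first.
  by rewrite {2}/d (negbTE a_u) run0.
by rewrite {2}/d a_u => /IH w_u b; rewrite inE => /orP[/eqP->|/w_u].
Qed.

(** Letters of [y] fix both states, [a] sets the state to 1 and every other letter resets it to 0. A
    word leading from 0 to 1 must have [a] as its last letter outside [y]. *)
Lemma End2_suffix x a y : u = x ++ a :: y -> a \notin y ->
  exists2 w, w \in words s & exists v z, w = v ++ a :: z /\ {subset z <= y}.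
Proof.
move=> def_u a_y.
pose d b i := if b \in y then minn i 1 else (b == a : nat).
have d_tame : tame 1 d by split=> [b i j|b i]; rewrite /d; case: ifP => _; lia.
have run1 w : {subset w <= y} -> run d 1 w = 1.
  elim: w => //= b w IH sub; rewrite /d sub ?inE ?eqxx //; apply: IH => c c_w.
  by apply: sub; rewrite inE c_w orbT.
have [w w_s] := holds_run (ltnSn 1) d_tame (holds_sym st_eq) (leq0n 1) u_t.
rewrite def_u run_cat /= {2}/d (negbTE a_y) eqxx run1 // => w_run; exists w => //.
elim/last_ind: w w_run {w_s} => //= w b IH; rewrite -cats1 run_cat /= {1}/d.
case: ifP => [b_y|_]; last by case: eqP => // -> _; exists w, [::].
rewrite leq_min => /andP[/IH[v [z [-> z_y]]] _]; exists v, (rcons z b).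
split=> [|c]; first by rewrite -cats1 -catA /= cats1.
by rewrite mem_rcons inE => /orP[/eqP->|/z_y].
Qed.

(* Build [v u <= s] letter by letter from the right; the prefix [v] is then
   removed by interpolating against a word of [s] over the letters of [u]. *)
Lemma ge_word_of_holds : s ≽ word_term u.
Proof.
have lastE v a : word_term (rcons v a) ≈ Mul (word_term (rcons v a)) (Var a).
  case: v => [|b v]; first by rewrite /= Mulxx.
  by rewrite -cats1 word_term_cat // -MulA (Mulxx (Var a)).
have step x y : u = x ++ y -> y != [::] -> exists v, s ≽ Mul v (word_term y).
  elim: y x => // a y IH x def_u _.
  have [a_y|a_y] := boolP (a \in y).
    have y0 : y != [::] by case: (y) a_y.
    have [|v hv] := IH (rcons x a) _ y0; first by rewrite cat_rcons.
    by exists v; rewrite word_term_cons // Mul_letter_absorb.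
  have [w w_s [v [z [def_w z_y]]]] := End2_suffix def_u a_y.
  exists (word_term (rcons v a)).
  have := ge_words w_s; rewrite def_w -cat_rcons.
  have [y_nil|y0] := eqVneq y [::].
    have -> : z = [::] by case: (z) z_y => // b z' /(_ b); rewrite y_nil inE eqxx => /(_ isT).
    by rewrite cats0 y_nil {1}lastE.
  have [|v' hv'] := IH (rcons x a) _ y0; first by rewrite cat_rcons.
  (* The suffix [z] is absorbed by [y], and doubling the last letter of [rcons v a] leaves a copy of
     [a] in front of [y]. *)
  move=> /ge_interpolate/(_ hv'); apply: ge_eqr.
  rewrite word_term_cons // MulA -lastE.
  have rcons0 : rcons v a != [::] by case: (v).
  have [->|z0] := eqVneq z [::]; first by rewrite cats0.
  by rewrite word_term_cat // -MulA Mul_word_absorb.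
have [v hv] := step [::] u erefl (words_neq_nil u_t).
have [w w_s w_u] := End2_subword.
have := ge_interpolate (ge_words w_s) hv; apply: ge_eqr.
by apply: Mul_word_absorb => //; apply: words_neq_nil w_s.
Qed.

End Conditions.

Lemma End2_finitely_based : End_finitely_based 2.
Proof.
exists End2_basis; split=> [|s t st_eq]; first exact: End2_basis_sound.
apply: ge_anti; apply: ge_of_words => w; apply: ge_word_of_holds => //.
exact: holds_sym.
Qed.

(** * Chains with at least three elements *)

Section SyntacticCongruence.

Variable X : pred (seq nat).

Definition fits (t : term) (p q : seq nat) :=
  forall u, u \in words t -> X (p ++ u ++ q).

(** Agreement of [fits] in all contexts is a congruence, so only substitution instances of the basis
    need checking. In a product the factors are exchanged one at a time, with the words of the other
    factor moved into the context. *)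
Lemma derivable_fits E :
  (forall s t sg p q, In (s, t) E ->
     fits (subst sg s) p q <-> fits (subst sg t) p q) ->
  forall s t, derivable E s t -> forall p q, fits s p q <-> fits t p q.
Proof.
move=> HE s t; elim=> {s t} [s t sg st p q|//|s t _ IH p q|s t u _ IH1 _ IH2 p q
  |s1 t1 s2 t2 _ IH1 _ IH2 p q|s1 t1 s2 t2 _ IH1 _ IH2 p q].
- exact: HE.
- by split=> /IH.
- by rewrite IH1.
- have fitsD a b : fits (Add a b) p q <-> fits a p q /\ fits b p q.
    split=> [H|[Ha Hb] u]; last by rewrite mem_cat => /orP[/Ha|/Hb].
    by split=> u hu; apply: H; rewrite mem_cat hu ?orbT.
  by rewrite !fitsD IH1 IH2.
- have fitsM a b : fits (Mul a b) p q <-> forall u, u \in words a -> fits b (p ++ u) q.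
    split=> [H u hu w hw|H u /allpairsP[[x y] /= [hx hy ->]]].
      by rewrite -catA (catA u); apply: H; apply/allpairsP; exists (u, w).
    by rewrite -catA catA; apply: H.
  have fitsM' a b : fits (Mul a b) p q <-> forall u, u \in words b -> fits a p (u ++ q).
    split=> [H u hu w hw|H u /allpairsP[[x y] /= [hx hy ->]]].
      by rewrite (catA w); apply: H; apply/allpairsP; exists (w, u).
    by rewrite -catA; apply: H.
  rewrite fitsM; transitivity (forall u, u \in words s1 -> fits t2 (p ++ u) q).
    by split=> H u /H; rewrite IH2.
  rewrite -fitsM fitsM'; transitivity (forall u, u \in words t2 -> fits t1 p (u ++ q)).
    by split=> H u /H; rewrite IH1.
  by rewrite -fitsM'.
Qed.

End SyntacticCongruence.

(** * Words lying below a sum of words on the chain 0 < 1 < 2, and three-state tests *)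

Definition dominated (X : seq (seq nat)) (t : seq nat) :=
  forall d p, tame 2 d -> p <= 2 -> exists2 x, x \in X & run d p t <= run d p x.

(** Erased letters are made to act as the identity on the states up to 2; [minn i 2] keeps this
    action bounded on all of nat. *)
Lemma dominated_filter (k : pred nat) X t :
  dominated X t -> dominated [seq filter k x | x <- X] (filter k t).
Proof.
move=> X_t d p [d_mono d_le] p_le; pose d' a i := if k a then d a i else minn i 2.
have d'_tame : tame 2 d'.
  split=> [a i j le_ij|a i]; rewrite /d'; case: ifP => _ //; last by lia.
    exact: d_mono.
  by lia.
have runE w q : q <= 2 -> run d q (filter k w) = run d' q w.
  elim: w q => //= a w IH q q_le; rewrite {2}/d'; case: ifP => _ /=; first exact: IH.
  by rewrite IH // (minn_idPl q_le).
have [x x_X le_x] := X_t d' p d'_tame p_le.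
by exists (filter k x); rewrite ?map_f // !runE.
Qed.

(** The test starts in state 1, and the first letter decides for good between 2, for [a], and 0. *)
Lemma dominated_head X a t : dominated X (a :: t) ->
  exists2 x, x \in X & ohead x = Some a.
Proof.
pose d b i := if i is i'.+1 then (if i' is 0 then (b == a).*2 else 2) else 0.
have d_tame : tame 2 d.
  split=> [b [|[|i]] [|[|j]] //=|b [|[|i]] //=]; by case: (b == a).
move=> /(_ d 1 d_tame isT)[x x_X].
have run02 w : run d 0 w = 0 /\ run d 2 w = 2 by elim: w.
rewrite /= {2}/d eqxx (run02 t).2 => le_x; exists x => //.
case: x le_x {x_X} => //= b x; case: eqP => [-> //|_].
by have [r0 _] := run02 x; rewrite -/d r0.
Qed.

(** Every letter acts as a constant, [a] as 1 and the others as 0, so only the last letter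
    counts. *)
Lemma dominated_last X a t : dominated X (rcons t a) ->
  exists2 x, x \in X & exists x', x = rcons x' a.
Proof.
pose d b (i : nat) := (b == a : nat).
have d_tame : tame 2 d by split=> [b i j _|b i] //; rewrite /d; case: (b == a).
move=> /(_ d 0 d_tame isT)[x x_X]; rewrite -cats1 run_cat /= {1}/d eqxx => le_x.
exists x => //; case/lastP: x le_x {x_X} => // x b.
by rewrite -cats1 run_cat /= {1}/d; case: eqP => // -> _; exists x; rewrite cats1.
Qed.

(** State 2 records that the factor has been seen; before that, state 1 records that the last letter
    was [a]. *)
Lemma dominated_infix2 X a b t : dominated X t -> infix [:: a; b] t ->
  exists2 x, x \in X & infix [:: a; b] x.
Proof.
pose d c i := match i with
  | 0 => (c == a : nat)
  | 1 => if c == b then 2 else (c == a : nat)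
  | _ => 2
  end.
have d_tame : tame 2 d.
  by split=> [c [|[|i]] [|[|j]] //=|c [|[|i]] //=]; case: (c == a); case: (c == b).
have run2 w : run d 2 w = 2 by elim: w.
move=> X_t /infixP[u [v def_t]]; have [x x_X] := X_t d 0 d_tame isT; rewrite {}def_t.
have -> : run d 0 (u ++ [:: a; b] ++ v) = 2.
  have dab q : d b (d a q) = 2.
    by case: q => [|[|q]] //=; rewrite eqxx /= ?eqxx //; case: (a == b); rewrite /= ?eqxx.
  by rewrite run_cat -[RHS](run2 v) -[in RHS](dab (run d 0 u)).
move=> le_x; exists x => //.
have: (run d 0 x = 1 -> exists x', x = rcons x' a) /\ (1 < run d 0 x -> infix [:: a; b] x).
  elim/last_ind: x {x_X le_x} => // x c [IH1 IH2]; rewrite -cats1 run_cat /=.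
  case run_x: (run d 0 x) => [|[|i]] /=.
  - by case: eqP => // ->; split=> // _; exists x; rewrite cats1.
  - have [x' ->] := IH1 run_x; case: eqP => [->|_].
      split=> // _; apply/infixP; exists x', [::].
      by rewrite -!cats1 -!catA.
    by case: eqP => // ->; split=> // _; exists (rcons x' a); rewrite cats1.
  - split=> // _; have: infix [:: a; b] x by apply: IH2; rewrite run_x.
    by move=> /infixP[u' [v' ->]]; apply/infixP; exists u', (v' ++ [:: c]); rewrite -!catA.
by case=> _; apply.
Qed.

(** * Words alternating between vertices (even letters) and marks of places (odd letters) *)

Definition mark (i : nat) : nat := i.*2.+1.

Definition shape (h : nat -> nat) (i k : nat) : seq nat :=
  flatten [seq [:: (h j).*2; mark j] | j <- iota i k].

Lemma shapeS h i k : shape h i k.+1 = (h i).*2 :: mark i :: shape h i.+1 k.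
Proof. by []. Qed.

Lemma shapeD h i k1 k2 : shape h i (k1 + k2) = shape h i k1 ++ shape h (i + k1) k2.
Proof. by rewrite /shape iotaD map_cat flatten_cat. Qed.

Lemma eq_shape g h i k : (forall j, i <= j < i + k -> g j = h j) ->
  shape g i k = shape h i k.
Proof. by move=> gh; congr flatten; apply/eq_in_map => j; rewrite mem_iota => /gh->. Qed.

Lemma filter_odd_shape h i k : filter odd (shape h i k) = [seq mark j | j <- iota i k].
Proof. by elim: k i => //= k IH i; rewrite !odd_double /= -IH. Qed.

Lemma infix2_shape h i k a b : infix [:: a; b] (shape h i k) ->
  (exists2 j, i <= j < i + k & a = (h j).*2 /\ b = mark j) \/
  (exists2 j, i <= j /\ j.+1 < i + k & a = mark j /\ b = (h j.+1).*2).
Proof.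
elim: k i => // k IH i; rewrite shapeS !infix_consl.
case/or3P=> [/=|/=|/IH].
- by rewrite ?prefix0s ?andbT => /andP[/eqP-> /eqP->]; left; exists i; lia.
- case: k {IH} => [|k] /=; first by rewrite andbF.
  by rewrite ?prefix0s ?andbT => /andP[/eqP-> /eqP->]; right; exists i; lia.
- by case=> -[j hj e]; [left|right]; exists j => //; lia.
Qed.

Lemma infix2_marks i k a b : infix [:: a; b] [seq mark j | j <- iota i k] ->
  exists2 j, i <= j /\ j.+1 < i + k & a = mark j /\ b = mark j.+1.
Proof.
elim: k i => // k IH i; rewrite -[iota i k.+1]/(i :: iota i.+1 k) map_cons infix_consl => /orP[|/IH[j hj e]].
  case: k {IH} => [|k] /=; first by rewrite andbF.
  by rewrite ?prefix0s ?andbT => /andP[/eqP-> /eqP->]; exists i; lia.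
by exists j => //; lia.
Qed.

Lemma mark_inj : injective mark.
Proof. by move=> i j; rewrite /mark; lia. Qed.

(** Each mark has only the next one as possible successor and [mark L.-1] has none, so the sequence
    can neither branch nor stop early. *)
Lemma marks_unique L i s : i < L ->
  (forall a b, infix [:: a; b] (mark i :: s) ->
     exists2 j, j.+1 < L & a = mark j /\ b = mark j.+1) ->
  last (mark i) s = mark L.-1 ->
  mark i :: s = [seq mark j | j <- iota i (L - i)].
Proof.
elim: s i => [|b s IH] i lt_iL H /=.
  by move/mark_inj => i_L; have -> : L - i = 1 by lia.
have [j lt_jL [/mark_inj eq_ij def_b]] : exists2 j, j.+1 < L & mark i = mark j /\ b = mark j.+1.
  by apply: H; rewrite infix_consl /= !eqxx ?prefix0s.
rewrite -{j}eq_ij in lt_jL def_b.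
rewrite def_b => last_s; have -> : L - i = (L - i.+1).+1 by lia.
rewrite -[iota i _]/(i :: iota i.+1 _) map_cons -IH // => a c ac; apply: H.
by rewrite infix_consl def_b ac orbT.
Qed.

(** The condition on two-letter factors forces vertices and marks to alternate, and the marks are
    known in order. The odd default of [last] lets the empty word through as the base case. *)
Lemma shape_of_infix2 (Q : nat -> pred nat) i k t :
  filter odd t = [seq mark j | j <- iota i k] ->
  (forall a, ohead t = Some a -> ~~ odd a) -> odd (last 1 t) ->
  (forall a b, infix [:: a; b] t ->
     (odd a && ~~ odd b) \/ exists2 j, b = mark j & exists2 v, a = v.*2 & Q j v) ->
  exists2 g, t = shape g i k & forall j, i <= j < i + k -> Q j (g j).
Proof.
elim: k i t => [|k IH] i t.
  case/lastP: t => [|t a] /= filt _; first by exists id => // j; lia.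
  by rewrite last_rcons => odd_a; move: filt; rewrite filter_rcons odd_a; case: (filter _ _).
case: t => // a t /= filt /(_ a erefl) even_a; move: filt; rewrite (negbTE even_a).
case: t => // b t /= filt last_t H.
have ab : infix [:: a; b] [:: a, b & t] by rewrite infix_consl /= !eqxx ?prefix0s.
case: (H a b ab); first by rewrite (negbTE even_a).
case=> j def_b [v def_a Qv]; move: filt; rewrite def_b /mark /= odd_double /= => -[ij filt].
have {ij} def_j : j = i by move: ij; rewrite /mark; lia.
rewrite {j}def_j in def_b Qv *.
case: (IH i.+1 t) => //.
- move=> c; case: t {filt last_t ab} H => // c' t H [<-].
  have bc : infix [:: b; c'] [:: a, b, c' & t].
    by rewrite infix_consl infix_consl /= !eqxx ?prefix0s orbT.
  case: (H b c' bc); first by case/andP.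
  by case=> j' _ [v' b_v' _]; move: def_b; rewrite b_v' /mark; lia.
- by move: last_t; case: (t).
- by move=> c1 c2 hc; apply: H; rewrite hc !orbT.
move=> g -> Qg; exists (fun j => if j == i then v else g j) => [|j hj].
  rewrite shapeS eqxx -def_a; congr [:: _, _ & _].
  by apply: eq_shape => j hj; case: eqP => //; lia.
by case: eqP => [->//|ne_ji]; apply: Qg; lia.
Qed.

(* A vertex letter in [D] lowers state 2 to 1, and the next mark either turns
   1 into 0, if its place is in [S], or restores 2. *)
Definition drop_act (S D : pred nat) (a q : nat) : nat :=
  if odd a then (if q < (if S a./2 then 2 else 1) then 0 else 2)
  else if D a./2 then minn q 1 else minn q 2.

Lemma drop_act_tame S D : tame 2 (drop_act S D).
Proof.
split=> [a i j|a i]; rewrite /drop_act; case: (odd a) => //.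
- by case: (S _); case: i j => [|[|i]] [|[|j]].
- by case: (D _); lia.
- by case: (S _); case: i => [|[|i]].
- by case: (D _); lia.
Qed.

(** After each mark the state is again 2, or it is 0 and stays there. *)
Lemma run_drop_act S D h i k :
  run (drop_act S D) 2 (shape h i k) =
    if all (fun j => S j ==> ~~ D (h j)) (iota i k) then 2 else 0.
Proof.
have act0 a : drop_act S D a 0 = 0.
  by rewrite /drop_act !min0n if_same; case: (odd a); case: (S _).
have run0 w : run (drop_act S D) 0 w = 0 by elim: w => //= a w; rewrite act0.
have act2 j : drop_act S D (mark j) (drop_act S D (h j).*2 2) =
    if S j ==> ~~ D (h j) then 2 else 0.
  rewrite /drop_act /mark odd_double doubleK /= odd_double /= uphalf_double.
  by case: (D (h j)); case: (S j).
elim: k i => // k IH i; rewrite shapeS /= act2.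
by case: (S i ==> _); rewrite /= ?IH ?run0.
Qed.

(** This compares [g] with the words of the sum at a few selected places only: if [g] avoids the
    vertices [D] there, so does one of them. *)
Lemma dominated_drop (I : eqType) (E : seq I) (h : I -> nat -> nat) g L (S D : pred nat) :
  dominated [seq shape (h e) 0 L | e <- E] (shape g 0 L) ->
  (forall j, j < L -> S j -> ~~ D (g j)) ->
  exists2 e, e \in E & forall j, j < L -> S j -> ~~ D (h e j).
Proof.
move=> dom gP; have [_ /mapP[e e_E ->]] := dom _ 2 (drop_act_tame S D) isT.
rewrite !run_drop_act; have -> : all (fun j => S j ==> ~~ D (g j)) (iota 0 L).
  by apply/allP => j; rewrite mem_iota => hj; apply/implyP; apply: gP.
case: ifP => // /allP he _; exists e => // j hj; apply/implyP; apply: he.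
by rewrite mem_iota.
Qed.

(** * Counting the cuts of a word into factors of a fixed word *)

Section Pieces.

Variable w : seq nat.

Definition bad_pair (a b : nat) : bool := ~~ infix [:: a; b] w.

Fixpoint bad_pairs (u : seq nat) : nat :=
  if u is a :: u' then
    (if u' is b :: _ then bad_pair a b : nat else 0) + bad_pairs u'
  else 0.

Lemma bad_pairs_infix u : infix u w -> bad_pairs u = 0.
Proof.
elim: u => // a u IH u_w; rewrite [LHS]/= IH ?addn0; last exact: consl_infix u_w.
case: u u_w {IH} => // b u /infixP[x [y def_w]].
rewrite /bad_pair; suff -> : infix [:: a; b] w by [].
by apply/infixP; exists x, (u ++ y).
Qed.

Lemma bad_pairs_cat_le u v : bad_pairs (u ++ v) <= bad_pairs u + bad_pairs v + 1.
Proof.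
elim: u => [|a u IH]; first by rewrite /=; lia.
rewrite cat_cons [bad_pairs (a :: _)]/= [bad_pairs (a :: u)]/=.
case: u IH => [|b u] IH; last by rewrite cat_cons -cat_cons; lia.
by rewrite cat0s; case: v {IH} => [|c v] /=; lia.
Qed.

Lemma bad_pairs_cat_ge u v : bad_pairs u + bad_pairs v <= bad_pairs (u ++ v).
Proof.
elim: u => [|a u IH] //.
rewrite cat_cons [bad_pairs (a :: _)]/= [bad_pairs (a :: u ++ v)]/=.
by case: u IH => [|b u] IH; [rewrite /= | rewrite cat_cons -cat_cons]; lia.
Qed.

(** A factor of [w] contains no bad pair, so bad pairs arise only at junctions of pieces. *)
Lemma bad_pairs_pieces us : all (fun u => infix u w) us -> bad_pairs (flatten us) <= size us.
Proof.
elim: us => //= u us IH /andP[/bad_pairs_infix u0 /IH]; have := bad_pairs_cat_le u (flatten us).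
by rewrite u0; lia.
Qed.

Lemma bad_pairs_shape h i k :
  (forall j, i <= j < i + k -> ~~ infix [:: (h j).*2; mark j] w) ->
  k <= bad_pairs (shape h i k).
Proof.
elim: k i => // k IH i H; rewrite shapeS -cat1s -[_ :: shape _ _ _]cat1s catA.
apply: leq_trans (bad_pairs_cat_ge _ _); rewrite /= /bad_pair H ?leqnn; last by lia.
by rewrite addn0 add1n ltnS; apply: IH => j hj; apply: H; lia.
Qed.

End Pieces.

(** * The clean word, its flips, and the words dominated by the flips *)

Section Construction.

Variables (P : seq (nat * nat)) (K : nat).
Hypotheses (P_uniq : uniq P) (P_lt : all (fun e => e.1 < e.2) P) (P_gt0 : 0 < size P).
Hypotheses (K_even : ~~ odd K) (K_gt1 : 1 < K).

Let M := size P.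
Let L := M * K.

(** The default pair [(0, 1)] is increasing, so [vertex_lt] also covers indices out of range. *)
Definition vertex (e : nat) (b : bool) : nat :=
  let xy := nth (0, 1) P e in if b then xy.2 else xy.1.

(** Each pair owns a block of [K] consecutive places, on which its two vertices alternate. *)
Definition clean (i : nat) : nat := vertex (i %/ K) (odd i).
Definition dirty (i : nat) : nat := vertex (i %/ K) (~~ odd i).
Definition flip (e i : nat) : nat := if i %/ K == e then dirty i else clean i.

Definition clean_word : seq nat := shape clean 0 L.
Definition flip_words : seq (seq nat) := [seq shape (flip e) 0 L | e <- iota 0 M].

Lemma vertex_lt e : vertex e false < vertex e true.
Proof.
rewrite /vertex; case: (ltnP e (size P)) => [lt_e|ge_e]; last by rewrite nth_default.
exact: (allP P_lt _ (mem_nth _ lt_e)).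
Qed.

Lemma clean_neq_dirty i : clean i != dirty i.
Proof. by have := vertex_lt (i %/ K); rewrite /clean /dirty; case: (odd i) => /=; lia. Qed.

Lemma flip_cases e i : flip e i = clean i \/ flip e i = dirty i.
Proof. by rewrite /flip; case: ifP; [right|left]. Qed.

(** Two representatives of the block of [e], one of each parity because [K] is even. *)
Definition place (e : nat) (b : bool) : nat := e * K + b.

Lemma place_own e b : place e b %/ K = e.
Proof. by rewrite /place divnMDl 1?divn_small ?addn0 //; case: b; lia. Qed.

Lemma odd_place e b : odd (place e b) = b.
Proof. by rewrite /place oddD oddM (negbTE K_even) andbF oddb. Qed.

Lemma place_lt e b : e < M -> place e b < L.
Proof.
move=> lt_e; apply: leq_trans (_ : e.+1 * K <= L); last by rewrite leq_mul2r lt_e orbT.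
by rewrite /place mulSn; case: b; lia.
Qed.

Lemma own_lt i : i < L -> i %/ K < M.
Proof. by move=> lt_i; rewrite ltn_divLR //; lia. Qed.

(** Distinct increasing pairs are distinct two-element sets, hence neither contains the other. *)
Lemma vertex_sep e e' : e < M -> e' < M -> e != e' ->
  exists b b', (forall c, vertex e b != vertex e' c) /\ (forall c, vertex e' b' != vertex e c).
Proof.
move=> lt_e lt_e' ne; have := vertex_lt e; have := vertex_lt e'.
have : nth (0, 1) P e != nth (0, 1) P e' by rewrite nth_uniq.
rewrite /vertex; case: (nth _ P e) (nth _ P e') => [x y] [x' y'] /=.
rewrite xpair_eqE => ne' lt' lt.
have [b hb] : exists b : bool, ((if b then y else x) != x') && ((if b then y else x) != y').
  by case: (boolP ((y != x') && (y != y'))) => h; [exists true|exists false]; lia.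
have [c hc] : exists b : bool, ((if b then y' else x') != x) && ((if b then y' else x') != y).
  by case: (boolP ((y' != x) && (y' != y))) => h; [exists true|exists false]; lia.
by exists b, c; split=> -[]; lia.
Qed.

Section Dominated.

Variable g : nat -> nat.
Hypothesis g_dom : dominated flip_words (shape g 0 L).
Hypothesis g_cd : forall i, i < L -> (g i == clean i) || (g i == dirty i).

(** Were [g j] clean, [g] would have the vertex [clean i] at neither [i] nor [j]. Every flip has it
    at one of them: at [j] if their pair is flipped, at [i] otherwise. *)
Lemma dominated_same_pair i j : i < L -> j < L -> i %/ K = j %/ K ->
  odd i != odd j -> g i = dirty i -> g j = dirty j.
Proof.
move=> lt_i lt_j own_ij odd_ij gi; case/orP: (g_cd lt_j) => [/eqP gj|/eqP//].
pose S : pred nat := pred2 i j; pose D : pred nat := pred1 (clean i).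
have cij : dirty j = clean i by rewrite /dirty /clean own_ij; case: (odd i) (odd j) odd_ij => [] [].
have [|e _ eP] := @dominated_drop _ _ _ g L S D g_dom.
  move=> k _ /orP[] /eqP->; rewrite /D /= ?gi ?gj -?cij ?clean_neq_dirty //.
  by rewrite cij eq_sym clean_neq_dirty.
have := eP i lt_i; have := eP j lt_j; rewrite /S /D /= !eqxx orbT /flip own_ij => /(_ isT).
by case: ifP => _; rewrite ?cij ?eqxx // => _ /(_ isT).
Qed.

(** Places of equal parity are compared through a place of the other parity in the same block. *)
Lemma dominated_own i j : i < L -> j < L -> i %/ K = j %/ K ->
  g i = dirty i -> g j = dirty j.
Proof.
move=> lt_i lt_j own_ij gi; have [odd_ij|odd_ij] := eqVneq (odd i) (odd j); last first.
  exact: dominated_same_pair gi.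
pose k := place (i %/ K) (~~ odd i); have lt_k : k < L by rewrite place_lt ?own_lt.
have gk : g k = dirty k.
  by apply: dominated_same_pair gi => //; rewrite ?place_own // odd_place; case: (odd i).
apply: dominated_same_pair gk => //; rewrite ?place_own //.
by rewrite odd_place odd_ij; case: (odd j).
Qed.

Lemma dominated_shape : shape g 0 L \in clean_word :: flip_words.
Proof.
have [/hasP[i]|no_dirty] := boolP (has (fun i => g i == dirty i) (iota 0 L)); last first.
  rewrite inE; apply/orP; left; apply/eqP/eq_shape => i /= lt_i.
  have := g_cd lt_i; move/hasPn/(_ i): no_dirty; rewrite mem_iota => /(_ lt_i)/negbTE->.
  by rewrite orbF => /eqP.
rewrite mem_iota => /= lt_i /eqP gi; rewrite inE; apply/orP; right; apply/mapP.
exists (i %/ K); first by rewrite mem_iota own_lt.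
apply: eq_shape => j /= lt_j; rewrite /flip; case: eqP => [own_ji|/eqP ne].
  exact: dominated_own gi.
case/orP: (g_cd lt_j) => /eqP // gj.
rewrite eq_sym in ne.
(* If a second pair were dirty, each of the two pairs has a vertex foreign to the other. At the
   places [k] and [k'], where the clean word carries these vertices, [g] avoids both, whereas any
   flip leaves one of the two places clean. *)
have [b [b' [hb hb']]] := vertex_sep (own_lt lt_i) (own_lt lt_j) ne.
pose k := place (i %/ K) b; pose k' := place (j %/ K) b'.
have lt_k : k < L by rewrite place_lt ?own_lt.
have lt_k' : k' < L by rewrite place_lt ?own_lt.
have gk : g k = dirty k by apply: dominated_own gi; rewrite ?place_own.
have gk' : g k' = dirty k' by apply: dominated_own gj; rewrite ?place_own.
pose S : pred nat := pred2 k k'; pose D : pred nat := pred2 (clean k) (clean k').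
have [|e _ eP] := @dominated_drop _ _ _ g L S D g_dom.
  move=> l _ /orP[] /eqP->; rewrite /D /= ?gk ?gk' negb_or [_ == clean k]eq_sym [_ == clean k']eq_sym.
    by rewrite clean_neq_dirty /clean /dirty !place_own !odd_place hb'.
  by rewrite clean_neq_dirty /clean /dirty !place_own !odd_place andbT hb.
have := eP k lt_k; have := eP k' lt_k'; rewrite /S /D /= !eqxx !orbT /flip !place_own.
move=> /(_ isT) + /(_ isT).
have [<-|_] := eqVneq (j %/ K) e; last by rewrite eqxx orbT.
by move=> _; rewrite (negbTE ne) /= eqxx.
Qed.

End Dominated.

Lemma infix2_clean_word i a : infix [:: a; mark i] clean_word -> a = (clean i).*2.
Proof.
case/infix2_shape=> -[j _ [-> //]]; first by move/mark_inj->.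
by rewrite /mark; lia.
Qed.

Lemma infix2_flip_word e a b : infix [:: a; b] (shape (flip e) 0 L) ->
  (odd a && ~~ odd b) \/
  exists2 j, b = mark j & exists2 v, a = v.*2 & (v == clean j) || (v == dirty j).
Proof.
case/infix2_shape=> -[j _ [-> ->]]; [right|left]; last first.
  by rewrite /mark /= !odd_double.
exists j => //; exists (flip e j) => //.
by case: (flip_cases e j) => ->; rewrite eqxx ?orbT.
Qed.

(** The ends, the two-letter factors and the sequence of marks are inherited from the flips; they
    force the form [shape g 0 L], to which [dominated_shape] applies. *)
Lemma dominated_words t : t != [::] -> dominated flip_words t ->
  t \in clean_word :: flip_words.
Proof.
move=> t0 t_dom.
have L_gt0 : 0 < L by rewrite muln_gt0 P_gt0; lia.
have last_odd : odd (last 1 t).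
  case/lastP: t t0 t_dom => // t a _ /dominated_last[_ /mapP[e _ ->] [x']].
  rewrite last_rcons -(ltn_predK L_gt0) -[L.-1.+1]addn1 shapeD /= -cat_rcons cats1.
  by move/rcons_inj=> [_ <-] /=; rewrite odd_double.
have head_even a : ohead t = Some a -> ~~ odd a.
  case: t t0 t_dom {last_odd} => // b t _ /dominated_head[_ /mapP[e _ ->]] + [<-].
  by rewrite -(ltn_predK L_gt0) shapeS /= => -[<-]; rewrite odd_double.
have t_infix a b : infix [:: a; b] t -> (odd a && ~~ odd b) \/
    exists2 j, b = mark j & exists2 v, a = v.*2 & (v == clean j) || (v == dirty j).
  by move=> /(dominated_infix2 t_dom)[_ /mapP[e _ ->]] /infix2_flip_word.
(* Once the vertices are erased all flips coincide, so the ends and two-letter factors of the mark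
   sequence are known. *)
have filt : filter odd t = [seq mark j | j <- iota 0 L].
  have f_dom := dominated_filter odd t_dom.
  have fE x : x \in [seq filter odd y | y <- flip_words] -> x = [seq mark j | j <- iota 0 L].
    by case/mapP=> _ /mapP[e _ ->] ->; exact: filter_odd_shape.
  case/lastP: t t0 {t_dom head_even t_infix} last_odd f_dom => // t a _.
  rewrite last_rcons filter_rcons => -> f_dom.
  have [_ /fE-> [x' last_x']] := dominated_last f_dom.
  case def_s: (rcons _ a) f_dom => [|b s] f_dom; first by move: def_s; case: (filter _ _).
  have [_ /fE->] := dominated_head f_dom; rewrite -{1}(ltn_predK L_gt0) /= => -[def_b].
  rewrite -def_b in f_dom def_s *; rewrite -[in RHS](subn0 L).
  apply: marks_unique => //.
    move=> c c' cc'; have [_ /fE->] := dominated_infix2 f_dom cc'.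
    by case/infix2_marks=> j [_ lt_j] e; exists j.
  have -> : last (mark 0) s = a by rewrite -[RHS](last_rcons 0 (filter odd t)) def_s.
  have := congr1 (last 0) last_x'; rewrite last_rcons => <-.
  have : last 0 [seq mark j | j <- iota 0 L.-1.+1] = mark L.-1.
    by rewrite -addn1 iotaD map_cat last_cat.
  by rewrite (ltn_predK L_gt0).
have [g def_t gP] := @shape_of_infix2 (fun j v => (v == clean j) || (v == dirty j)) 0 L t
  filt head_even last_odd t_infix.
rewrite def_t in t_dom *; apply: dominated_shape => // i lt_i; exact: gP.
Qed.

Lemma clean_notin_flip : clean_word \notin flip_words.
Proof.
apply/mapP=> -[e]; rewrite mem_iota /= => lt_e eq_w.
pose i := place e false; have lt_i : i < L by rewrite place_lt.
have : infix [:: (flip e i).*2; mark i] clean_word.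
  rewrite eq_w; have -> : L = i + (L - i.+1).+1 by lia.
  rewrite shapeD add0n shapeS; apply/infixP.
  by exists (shape (flip e) 0 i), (shape (flip e) i.+1 (L - i.+1)).
move/infix2_clean_word/double_inj; rewrite /flip place_own eqxx => /esym/eqP.
by rewrite (negbTE (clean_neq_dirty i)).
Qed.

Lemma flip_pieces us : flatten us \in flip_words ->
  all (fun u => infix u clean_word) us -> K <= size us.
Proof.
case/mapP=> e; rewrite mem_iota /= => lt_e def_us /(@bad_pairs_pieces clean_word).
rewrite def_us; apply: leq_trans.
(* The places split into those before the block of [e], the block itself, and those after it; only
   the block is counted. *)
have -> : L = e * K + (K + (M - e.+1) * K).
  by rewrite /L -mulSn -mulnDl; congr (_ * _); lia.
rewrite !shapeD; apply: leq_trans (bad_pairs_cat_ge _ _ _).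
apply: leq_trans (leq_addl _ _); apply: leq_trans (bad_pairs_cat_ge _ _ _).
apply: leq_trans (leq_addr _ _); apply: bad_pairs_shape => j hj.
apply/negP => /infix2_clean_word/double_inj; rewrite /flip.
have -> : j %/ K = e by nia.
by rewrite eqxx => /esym/eqP; rewrite (negbTE (clean_neq_dirty j)).
Qed.

End Construction.

(** * Invariance of the set of flips under short identities *)

Definition has_infix (W : seq nat) (sg : nat -> term) (a : nat) : bool :=
  has (fun u => infix u W) (words (sg a)).

Lemma choices_has_infix W sg w y : y \in choices sg w -> infix y W ->
  all (has_infix W sg) w.
Proof.
elim: w y => //= a w IH y /allpairsP[[u v] /= [hu hv ->]] uv_W; apply/andP; split.
  by apply/hasP; exists u => //; apply: catr_infix uv_W.
by apply: IH hv _; apply: catl_infix uv_W.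
Qed.

Lemma has_infix_choices W sg w : all (has_infix W sg) w ->
  exists us, [/\ flatten us \in choices sg w, size us = size w & all (fun u => infix u W) us].
Proof.
elim: w => [|a w IH] /=; first by exists [::].
case/andP=> /hasP[u hu u_W] /IH[us [us_w sz us_W]]; exists (u :: us) => /=.
split; rewrite ?sz ?u_W //; by apply/allpairsP; exists (u, flatten us).
Qed.

(** The identity makes [p ++ y ++ q] dominated by the flips, hence a flip or the clean word. In the
    latter case a further test finds a word of [s] whose letters can all be replaced by factors of
    the clean word, giving a flip with too few pieces. *)
Lemma fits_flip m n P K s t sg p q :
  uniq P -> all (fun e => e.1 < e.2) P -> 0 < size P -> ~~ odd K -> n.+2 < K ->
  2 < m -> holds_in_End m (t, s) -> (forall w, w \in words s -> size w <= n) ->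
  fits (mem (flip_words P K)) (subst sg s) p q -> fits (mem (flip_words P K)) (subst sg t) p q.
Proof.
move=> P_uniq P_lt P_gt0 K_even K_gt m_gt2 ts_eq s_n s_fits y y_t.
have K_gt1 : 1 < K by lia.
have y_dom : dominated (flip_words P K) (p ++ y ++ q).
  move=> d i d_tame i_le.
  have [y' y'_s le_y] := holds_run m_gt2 d_tame (holds_subst sg ts_eq)
    (run_tame_le p d_tame i_le) y_t.
  exists (p ++ y' ++ q); first exact: s_fits.
  by rewrite !run_cat; apply: (run_tame_mono q d_tame).
have pyq0 : p ++ y ++ q != [::].
  by move: (words_neq_nil y_t); case: (p) (y) => [|? ?] [|? ?].
have := dominated_words P_uniq P_lt P_gt0 K_even K_gt1 pyq0 y_dom.
rewrite inE => /orP[/eqP y_clean|//].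
set W := clean_word P K in y_clean.
have /mem_words_subst[w w_t y_w] := y_t.
have y_W : infix y W by apply/infixP; exists p, q.
(* State 1 survives exactly those words all of whose letters can be replaced by a factor of [W]. *)
pose d a i := if has_infix W sg a then minn i 2 else 0.
have d_tame : tame 2 d by split=> [a i j|a i]; rewrite /d; case: ifP => _; lia.
have d0 a : d a 0 = 0 by rewrite /d min0n if_same.
have run0 u : run d 0 u = 0 by elim: u => //= a u; rewrite d0.
have runE u : run d 1 u = all (has_infix W sg) u.
  by elim: u => //= a u IH; rewrite {2}/d; case: has_infix; rewrite ?run0.
have [w' w'_s] := holds_run m_gt2 d_tame ts_eq (isT : 1 <= 2) w_t.
rewrite !runE (choices_has_infix y_w y_W); case: (boolP (all _ w')) => // w'_W _.
have [us [us_w' sz us_W]] := has_infix_choices w'_W.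
(* Beside the at most [n] pieces for the letters of [w'], the context contributes the two pieces [p]
   and [q]. *)
have : flatten (p :: rcons us q) \in flip_words P K.
  rewrite /= -cats1 flatten_cat /= cats0; apply: s_fits.
  by apply/mem_words_subst; exists w'.
move/(flip_pieces P_uniq P_lt P_gt0 K_even K_gt1); rewrite /= all_rcons us_W.
have -> : infix p W by apply/infixP; exists [::], (y ++ q); rewrite y_clean.
have -> : infix q W by apply/infixP; exists (p ++ y), [::]; rewrite cats0 -catA y_clean.
by move=> /(_ isT); rewrite size_rcons sz leqNgt (leq_ltn_trans _ K_gt) // !ltnS s_n.
Qed.

(** * An identity that escapes a given finite basis *)

Fixpoint sum_words (x : seq nat) (X : seq (seq nat)) : term :=
  if X is y :: X' then Add (word_term x) (sum_words y X') else word_term x.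

Lemma words_word_term w : w != [::] -> words (word_term w) = [:: w].
Proof. by elim: w => // a [|b w] //= -> //. Qed.

Lemma words_sum_words x X : all (fun w => w != [::]) (x :: X) ->
  words (sum_words x X) = x :: X.
Proof.
elim: X x => [|y X IH] x /=; first by rewrite andbT => /words_word_term.
by case/andP=> x0 yX; rewrite words_word_term // IH.
Qed.

Lemma run_shape_eq S (d : nat -> S -> S) g h : (forall j, d (g j).*2 = d (h j).*2) ->
  forall i k q, run d q (shape g i k) = run d q (shape h i k).
Proof. by move=> gh i k; elim: k i => // k IH i q; rewrite !shapeS /= gh IH. Qed.

Definition increasing_pairs (N : nat) : seq (nat * nat) :=
  [seq e <- [seq (x, y) | x <- iota 0 N, y <- iota 0 N] | e.1 < e.2].

Lemma mem_increasing_pairs N x y : ((x, y) \in increasing_pairs N) = (x < y < N).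
Proof.
rewrite mem_filter /=; case: ltnP => //= lt_xy.
apply/allpairsP/idP => [[[x' y'] /= []]|lt_yN].
  by rewrite !mem_iota => _ lt_y' [_ ->].
by exists (x, y); rewrite /= !mem_iota; split=> //; lia.
Qed.

Lemma flip_run_eq S (d : nat -> S -> S) P K e q : e < size P ->
  (forall b, d (vertex P e b).*2 = d (vertex P e false).*2) ->
  run d q (clean_word P K) = run d q (shape (flip P K e) 0 (size P * K)).
Proof.
move=> lt_e eq_v; apply: run_shape_eq => j; rewrite /flip; case: eqP => // own_j.
by rewrite /clean /dirty own_j eq_v [RHS]eq_v.
Qed.

Lemma End_not_finitely_based m : 2 < m -> ~ End_finitely_based m.
Proof.
move=> m_gt2 [E [E_holds E_complete]].
have [n E_n] := words_bounded E.
(* [K] is even and exceeds [n + 2], the largest possible number of pieces; [N] exceeds the number of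
   self-maps of the chain, for the pigeonhole argument. *)
pose K := (n + 3).*2; pose N := #|{ffun 'I_m -> 'I_m}|.+1; pose P := increasing_pairs N.
have P_uniq : uniq P.
  by rewrite filter_uniq // allpairs_uniq ?iota_uniq // => -[? ?] [? ?].
have P_lt : all (fun e => e.1 < e.2) P by apply/allP=> e; rewrite mem_filter => /andP[].
have P_gt0 : 0 < size P.
  rewrite -has_predT; apply/hasP; exists (0, 1); rewrite // mem_increasing_pairs /= ltnS.
  by apply/card_gt0P; exists [ffun x => x].
have K_even : ~~ odd K by rewrite odd_double.
have K_gt : n.+2 < K by rewrite /K; lia.
have E_fits s t sg p q : In (s, t) E ->
    fits (mem (flip_words P K)) (subst sg s) p q <-> fits (mem (flip_words P K)) (subst sg t) p q.
  move=> st_E; have st_eq := E_holds _ st_E; have st_n := E_n _ _ st_E.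
  split; apply: (@fits_flip m n) => //; try exact: holds_sym.
    by move=> w w_s; apply: st_n; rewrite mem_cat w_s.
  by move=> w w_t; apply: st_n; rewrite mem_cat w_t orbT.
have shape0 h : shape h 0 (size P * K) != [::].
  have : 0 < size P * K by rewrite muln_gt0 P_gt0; lia.
  by case: (size P * K).
have flip0 : all (fun w => w != [::]) (flip_words P K) by apply/allP=> _ /mapP[e _ ->].
case def_X : (flip_words P K) flip0 => [|x X] flip0.
  by have := congr1 size def_X; rewrite size_map size_iota => P0; rewrite P0 in P_gt0.
have TE := words_sum_words flip0.
pose T := sum_words x X; pose W := clean_word P K.
have WE : words (word_term W) = [:: W] by apply: words_word_term; apply: shape0.
have T_eq : holds_in_End m (Add T (word_term W), T).
  apply: holds_words => v q _; split=> w /=; last first.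
    by move=> w_T; exists w => //; rewrite mem_cat w_T.
  rewrite WE mem_cat => /orP[w_T|]; first by exists w.
  rewrite inE => /eqP->{w}.
  (* By pigeonhole two vertices receive the same map, and flipping their pair does not change the
     run of [W]. *)
  have /injectivePn[a [b ne_ab eq_ab]] : ~~ injectiveb (fun a : 'I_N => v (val a).*2).
    by apply/negP=> /injectiveP/leq_card; rewrite card_ord ltnn.
  wlog lt_ab : a b ne_ab eq_ab / a < b.
    move=> H; case: (ltngtP a b) => [|lt_ba|/val_inj eq]; first exact: H.
      by apply: (H b a) => //; rewrite eq_sym.
    by rewrite eq eqxx in ne_ab.
  have ab_P : (val a, val b) \in P by rewrite mem_increasing_pairs lt_ab /=.
  have lt_e : index (val a, val b) P < size P by rewrite index_mem.
  exists (shape (flip P K (index (val a, val b) P)) 0 (size P * K)).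
    by rewrite TE -def_X; apply: map_f; rewrite mem_iota.
  rewrite -(@flip_run_eq _ (fun a => v a) P K) // => -[] //.
  by move: eq_ab; rewrite /vertex nth_index //= => ->.
(* [T] fits the empty context, so by invariance the sum of [T] and [W] does too, which would make
   [W] a flip. *)
have := derivable_fits E_fits (E_complete _ _ T_eq) [::] [::].
case=> _ /(_ _)/(_ W); rewrite cats0 /= mem_cat WE inE eqxx orbT => H.
have : W \in flip_words P K.
  by apply: H => // u; rewrite TE -def_X cats0.
by apply/negP; apply: clean_notin_flip => //; lia.
Qed.

Theorem theorem6p4 (m : nat) : 1 <= m -> (End_finitely_based m <-> m <= 2).
Proof.
move=> m_gt0; split=> [fb|].
  by rewrite leqNgt; apply/negP => /End_not_finitely_based.
case: m m_gt0 => [|[|[|m]]] // _ _; first exact: End1_finitely_based.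
exact: End2_finitely_based.
Qed.
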